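(* Let $Q\subset\mathbb{R}^d$ be a closed convex bounded set, let $f$ have $L_3$-Lipschitz third-order derivative, and let $f$ be uniformly convex of degree $q$, $2\le q\le4$, on $Q$, i.e. there is $\sigma_q>0$ with $$f(y)\ge f(x)+\langle\nabla f(x),y-x\rangle+\frac{\sigma_q}{q}\|y-x\|_2^q\qquad\forall x,y\in Q.$$ Let $x_*=\arg\min_{x\in Q}f(x)$, $f^*=f(x_* )$, and let $z_k$, $k\ge0$, be generated by the Restarted Hyperfast Second-Order Method described in the context, with $f(z_0)-f^*\le\Delta_0$. Then for all $k\ge0$ $$\frac{\sigma_q}{q}\|z_k-x_*\|_2^q\le f(z_k)-f^*\le\Delta_0\cdot2^{-k},$$ and the total number of steps of the basic Hyperfast method (used to produce $z_k$) is bounded by $$\left(2\hat c\,q^{\frac4q}\right)^{\frac15}\frac{L_3^{\frac15}}{\sigma_q^{\frac4{5q}}}\,\Delta_0^{\frac{4-q}{5q}}\cdot\sum_{i=0}^k2^{-i\frac{4-q}{5q}}+k.$$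
   Context: **Basic Hyperfast second-order method.** A method with constant $\hat c=48$ such that, for the problem $\min_{x\in Q}f(x)$ with convex $f$ having $L_3$-Lipschitz third-order derivative, started from $z\in Q$, it outputs after $N\ge1$ steps a point $y_N\in Q$ with $f(y_N)-f^*\le\hat cL_3\|z-x_*\|_2^4/N^5$. **Restarted Hyperfast Second-Order Method.** Input: $q$, $\sigma_q$, $z_0\in Q$, $\Delta_0>0$ with $f(z_0)-f^*\le\Delta_0$. For $k=0,1,\dots$: set $$\Delta_k=\Delta_0\cdot2^{-k},\qquad N_k=\max\left\{\left\lceil\left(\frac{2\hat cL_3q^{\frac4q}}{\sigma_q^{\frac4q}}\Delta_k^{\frac{4-q}{q}}\right)^{\frac15}\right\rceil,1\right\},$$ and let $z_{k+1}=y_{N_k}$ be the output of the basic Hyperfast method started from $z_k$ and run for $N_k$ steps. *)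

(* Defs.v *)
From HB Require Import structures.
From mathcomp Require Import all_boot all_order all_algebra.
From mathcomp Require Import all_classical all_reals all_analysis.
Import Order.TTheory GRing.Theory Num.Theory.
Import numFieldNormedType.Exports.

Set Implicit Arguments.
Unset Strict Implicit.
Unset Printing Implicit Defensive.

Local Open Scope classical_set_scope.
Local Open Scope ring_scope.

Section Smoothness.
Variables (R : realType) (d : nat).
Notation V := 'rV[R]_d.

Definition dot (u v : V) : R := \sum_(i < d) u 0 i * v 0 i.

(* The library norm on row vectors is the sup norm, hence this definition.
   The two norms have the same open, closed and bounded sets. *)
Definition norm2 (u : V) : R := Num.sqrt (dot u u).

Definition gradient (f : V -> R) (x : V) : V :=
  \row_(i < d) 'D_(delta_mx 0 i) f x.

(* Since V has finite dimension, this is three-fold Frechet differentiability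
   at every point of U: a map into linear (or bilinear) forms is differentiable
   iff its evaluation at each fixed vector (or pair of vectors) is. *)
Definition thrice_differentiable_on (U : set V) (f : V -> R) : Prop :=
  forall x, U x ->
    [/\ differentiable f x,
        forall u, differentiable ('D_u f) x &
        forall u v, differentiable ('D_v ('D_u f)) x].

Definition third_derivative (f : V -> R) (x u v w : V) : R :=
  'D_w ('D_v ('D_u f)) x.

(* Extended-real valued, so that an unbounded form has norm +oo. *)
Definition trilinear_norm (T : V -> V -> V -> R) : \bar R :=
  ereal_sup [set r : \bar R | exists u v w : V,
    [/\ norm2 u <= 1, norm2 v <= 1, norm2 w <= 1 & r = (`|T u v w|)%:E]].

(* The derivatives at points of Q are two-sided, so f is required to be smooth
   on an open neighbourhood of Q; the Lipschitz bound is only asked on Q. *)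
Definition lipschitz_third_derivative (Q : set V) (f : V -> R) (L3 : R) : Prop :=
  [/\ 0 <= L3,
      exists U : set V, [/\ open U, Q `<=` U & thrice_differentiable_on U f] &
      forall x y, Q x -> Q y ->
        (trilinear_norm (fun u v w =>
            (third_derivative f x u v w - third_derivative f y u v w)%R)
         <= (L3 * norm2 (x - y))%:E)%E].

Definition uniformly_convex (Q : set V) (f : V -> R) (q sigma : R) : Prop :=
  forall x y, Q x -> Q y ->
    f y >= f x + dot (gradient f x) (y - x) + sigma / q * norm2 (y - x) `^ q.

Definition is_argmin (Q : set V) (f : V -> R) (x : V) : Prop :=
  Q x /\ forall y, Q y -> f x <= f y.

End Smoothness.

Section Hyperfast.
Variables (R : realType) (d : nat).
Notation V := 'rV[R]_d.

Definition hyperfast_const : R := 48.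

(* [M Q f L3 z N] is the output y_N after N steps from z on the problem of
   minimizing f over Q. *)
Definition opt_method : Type := set V -> (V -> R) -> R -> V -> nat -> V.

(* The guarantee is with respect to every minimizer, as f need not have only
   one when it is merely convex. *)
Definition basic_hyperfast (M : opt_method) : Prop :=
  forall (Q : set V) (f : V -> R) (L3 : R) (xs z : V) (N : nat),
    closed Q -> convex_set Q -> bounded_set Q ->
    convex_function Q f -> lipschitz_third_derivative Q f L3 ->
    is_argmin Q f xs -> Q z -> (1 <= N)%N ->
    Q (M Q f L3 z N) /\
    f (M Q f L3 z N) - f xs
      <= hyperfast_const * L3 * norm2 (z - xs) ^+ 4 / N%:R ^+ 5.

Definition restart_Delta (Delta0 : R) (k : nat) : R := Delta0 * 2 ^- k.

Definition restart_steps (L3 q sigma Delta0 : R) (k : nat) : nat :=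
  `|Num.max (Num.ceil
      ((2 * hyperfast_const * L3 * q `^ (4 / q) / sigma `^ (4 / q)
        * restart_Delta Delta0 k `^ ((4 - q) / q)) `^ (1 / 5))) 1|%N.

Fixpoint restarted_hyperfast (M : opt_method) (Q : set V) (f : V -> R)
    (L3 q sigma Delta0 : R) (z0 : V) (k : nat) : V :=
  if k is k'.+1 then
    M Q f L3 (restarted_hyperfast M Q f L3 q sigma Delta0 z0 k')
      (restart_steps L3 q sigma Delta0 k')
  else z0.

(* Steps used to produce z_k, that is, those of restarts 0, ..., k - 1. *)
Definition total_steps (L3 q sigma Delta0 : R) (k : nat) : nat :=
  (\sum_(i < k) restart_steps L3 q sigma Delta0 i)%N.

End Hyperfast.

Arguments hyperfast_const {R}.

(* Main.v *)
Require Import Defs.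
From HB Require Import structures.
From mathcomp Require Import all_boot all_order all_algebra.
From mathcomp Require Import all_classical all_reals all_analysis.
From mathcomp Require Import ring lra.
Import Order.TTheory GRing.Theory Num.Theory.
Import numFieldNormedType.Exports.
Local Open Scope classical_set_scope.
Local Open Scope ring_scope.

(** Along a segment, uniform convexity of degree [q] improves the convexity
    inequality by a multiple of the [q]-th power of the length
    ([uniformly_convex_segment]).  This makes [f] convex, so that the basic
    method applies, and it makes [f] grow at least like
    [sigma / q * norm2 (x - xs) `^ q] away from its minimizer
    ([uniformly_convex_growth]), which is the lower bound of the theorem.

    The growth bound converts a gap at most [Delta_k] into a bound on the
    distance of [z_k] to [xs].  Inserted in the guarantee of the basic method,
    which is of order [norm2 (z_k - xs) ^+ 4 / N ^+ 5], it shows that [N_k]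
    steps are enough to halve the gap ([restart_halves_gap]); induction on the
    restarts gives the upper bound ([restart_invariant]).

    Finally [N_k] exceeds the real number that it rounds up by at most 1, and
    these real numbers form a geometric sequence ([restart_powR_geometric]),
    so summing them gives the bound on the total number of steps. *)

Set Implicit Arguments.
Unset Strict Implicit.

(** * Euclidean inner product and norm *)

Lemma dotZr (R : realType) (d : nat) (c : R) (u v : 'rV[R]_d) :
  dot u (c *: v) = c * dot u v.
Proof. by rewrite /dot mulr_sumr; apply: eq_bigr => i _; rewrite mxE mulrCA. Qed.

Lemma norm2Z (R : realType) (d : nat) (c : R) (u : 'rV[R]_d) :
  norm2 (c *: u) = `|c| * norm2 u.
Proof.
rewrite /norm2 dotZr /dot.
under eq_bigr => i _ do rewrite mxE -mulrA.
by rewrite -mulr_sumr mulrA -expr2 sqrtrM ?sqr_ge0// sqrtr_sqr.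
Qed.

Lemma norm2_ge0 (R : realType) (d : nat) (u : 'rV[R]_d) : 0 <= norm2 u.
Proof. exact: sqrtr_ge0. Qed.

(** * Consequences of uniform convexity *)

Lemma convex_set_segment (R : realType) (d : nat) (Q : set 'rV[R]_d) (t : R)
    (x y : 'rV[R]_d) :
  convex_set Q -> 0 <= t -> t <= 1 -> Q x -> Q y -> Q (t *: x + (1 - t) *: y).
Proof.
move=> cQ t0 t1 Qx Qy.
by have := cQ x y (Itv01 t0 t1); rewrite !inE; exact.
Qed.

(** The lower bound at the intermediate point, evaluated at the two endpoints
    and averaged with weights [t] and [1 - t]: the displacements [x - m] and
    [y - m] are [(1 - t) *: (x - y)] and [- t *: (x - y)], so the gradient
    terms cancel, whatever vector the gradient is. *)
Lemma uniformly_convex_segment (R : realType) (d : nat) (Q : set 'rV[R]_d)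
    (f : 'rV[R]_d -> R) (q sigma t : R) (x y : 'rV[R]_d) :
  convex_set Q -> uniformly_convex Q f q sigma ->
  0 <= t -> t <= 1 -> Q x -> Q y ->
  f (t *: x + (1 - t) *: y)
    + sigma / q * (t * (1 - t) `^ q + (1 - t) * t `^ q) * norm2 (x - y) `^ q
  <= t * f x + (1 - t) * f y.
Proof.
move=> cQ ucf t0 t1 Qx Qy; set m := t *: x + (1 - t) *: y.
have t1' : 0 <= 1 - t by rewrite subr_ge0.
have Qm : Q m by exact: convex_set_segment.
have xm : x - m = (1 - t) *: (x - y).
  rewrite /m; apply/rowP => i; rewrite !mxE; ring.
have ym : y - m = (- t) *: (x - y).
  rewrite /m; apply/rowP => i; rewrite !mxE; ring.
have := ucf _ _ Qm Qx; have := ucf _ _ Qm Qy.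
rewrite xm ym !dotZr !norm2Z normrN !ger0_norm// !powRM ?norm2_ge0//.
move=> /(ler_wpM2l t1') hy /(ler_wpM2l t0) hx.
apply: le_trans (lerD hx hy); rewrite le_eqVlt; apply/orP; left.
by apply/eqP; ring.
Qed.

Lemma uniformly_convex_convex (R : realType) (d : nat) (Q : set 'rV[R]_d)
    (f : 'rV[R]_d -> R) (q sigma : R) :
  convex_set Q -> 0 <= q -> 0 <= sigma -> uniformly_convex Q f q sigma ->
  convex_function Q f.
Proof.
move=> cQ q0 s0 ucf t x y /[!inE] Qx Qy.
have t0 : 0 <= t%:num by [].
have t1 : t%:num <= 1 by [].
suff: f (t%:num *: (x : 'rV[R]_d) + (1 - t%:num) *: (y : 'rV[R]_d))
    <= t%:num * f x + (1 - t%:num) * f y by [].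
apply: le_trans (uniformly_convex_segment cQ ucf t0 t1 Qx Qy).
by rewrite lerDl !mulr_ge0 ?addr_ge0 ?mulr_ge0 ?invr_ge0 ?powR_ge0 ?subr_ge0.
Qed.

(** The passage to the limit [s -> 1], done by an explicit choice of [s]. *)
Lemma le_of_powR_scaled_le (R : realType) (a b q : R) :
  0 < q -> 0 <= a ->
  (forall s, 0 < s -> s < 1 -> s `^ q * b <= a) -> b <= a.
Proof.
move=> q0 a0 h; rewrite leNgt; apply/negP => ab.
have b0 : 0 < b by exact: le_lt_trans ab.
(* [s] is chosen so that [s `^ q * b] is the midpoint of [a] and [b]. *)
pose c := (a + b) / 2 / b.
have c0 : 0 < c by rewrite /c !divr_gt0 ?ltr_wpDl.
have c1 : c < 1 by rewrite /c ltr_pdivrMr// mul1r; lra.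
have sq : (c `^ q^-1) `^ q = c by rewrite -powRrM mulVf ?gt_eqF// powRr1 ?ltW.
have s1 : c `^ q^-1 < 1.
  have one_powR : 1 `^ q^-1 = 1 :> R by rewrite powR1.
  rewrite -[ltRHS]one_powR.
  by apply: gt0_ltr_powR; rewrite ?invr_gt0 ?nnegrE ?(ltW c0).
have := h _ (powR_gt0 q^-1 c0) s1.
rewrite sq /c divfK ?gt_eqF//; lra.
Qed.

(** Growth of order [q] away from a minimizer is usually derived from the
    first-order optimality condition.  Here it follows from the inequality on
    segments alone: at a point of the segment [xs, x] the value of [f] is at
    least [f xs]; after division by the weight of [x] the constant is
    [sigma / q] times [s `^ q], and [s], the weight of [xs], tends to 1. *)
Lemma uniformly_convex_growth (R : realType) (d : nat) (Q : set 'rV[R]_d)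
    (f : 'rV[R]_d -> R) (q sigma : R) (xs x : 'rV[R]_d) :
  convex_set Q -> 0 < q -> 0 <= sigma -> uniformly_convex Q f q sigma ->
  is_argmin Q f xs -> Q x ->
  sigma / q * norm2 (x - xs) `^ q <= f x - f xs.
Proof.
move=> cQ q0 s0 ucf [Qxs xsmin] Qx.
apply: (le_of_powR_scaled_le q0); first by rewrite subr_ge0 xsmin.
move=> s s_gt0 s_lt1.
have t0 : 0 < 1 - s by rewrite subr_gt0.
have t1 : 1 - s <= 1 by rewrite gerBl ltW.
have := uniformly_convex_segment cQ ucf (ltW t0) t1 Qx Qxs.
have := xsmin _ (convex_set_segment cQ (ltW t0) t1 Qx Qxs).
rewrite subKr; set m := f (_ + _); set n := norm2 _ `^ q => hm hu.
rewrite -(ler_pM2l t0).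
have : 0 <= sigma / q * (s * (1 - s) `^ q) * n.
  by rewrite !mulr_ge0 ?invr_ge0 ?powR_ge0// ltW.
move: hu; set p := s `^ q; set p' := (1 - s) `^ q; set w := sigma / q.
move=> hu hp; lra.
Qed.

(** * Number of steps of one restart *)

(** The number of steps is tuned for exactly this.  With [A] the base of the
    power [1 / 5], the growth bound turns [D] into
    [r ^+ 4 <= (q * D / sigma) `^ (4 / q)], and splitting [D `^ (4 / q)] as
    [D `^ ((4 - q) / q) * D] gives [2 * (c * L * r ^+ 4) <= A * D], while
    [A <= N ^+ 5]. *)
Lemma restart_halves_gap (R : realType) (c L q sigma D r N : R) :
  0 <= c -> 0 <= L -> 0 < q -> 0 < sigma -> 0 < D -> 0 <= r -> 0 < N ->
  sigma / q * r `^ q <= D ->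
  (2 * c * L * q `^ (4 / q) / sigma `^ (4 / q) * D `^ ((4 - q) / q)) `^ (1 / 5)
    <= N ->
  c * L * r ^+ 4 / N ^+ 5 <= D / 2.
Proof.
move=> c0 L0 q0 s0 D0 r0 N0 hr; set A := (X in X `^ _) => hA.
have A0 : 0 <= A.
  by rewrite !mulr_ge0 ?invr_ge0 ?powR_ge0.
have AN : A <= N ^+ 5.
  have -> : A = (A `^ (1 / 5)) ^+ 5.
    by rewrite -powR_mulrn ?powR_ge0// -powRrM divfK// powRr1.
  by rewrite ler_pXn2r// ?nnegrE ?powR_ge0 ?ltW.
have sr : sigma `^ (4 / q) * r ^+ 4 <= q `^ (4 / q) * D `^ (4 / q).
  have -> : r ^+ 4 = (r `^ q) `^ (4 / q).
    by rewrite -powRrM mulrC divfK ?gt_eqF// powR_mulrn.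
  rewrite -!powRM ?powR_ge0 ?(ltW s0) ?(ltW q0) ?(ltW D0)//; apply: ge0_ler_powR.
  - by rewrite divr_ge0 ?ltW.
  - by rewrite nnegrE mulr_ge0 ?powR_ge0 ?ltW.
  - by rewrite nnegrE mulr_ge0 ?ltW.
  - by rewrite -ler_pdivrMl// mulrA [_^-1 * _]mulrC.
have Dq : D `^ (4 / q) = D `^ ((4 - q) / q) * D.
  rewrite -[X in _ = _ * X](powRr1 (ltW D0)) -powRD; last first.
    by rewrite (gt_eqF D0) implybT.
  by congr (_ `^ _); field; rewrite gt_eqF.
have S0 : 0 < sigma `^ (4 / q) by exact: powR_gt0.
have hAD : 2 * (c * L * r ^+ 4) <= A * D.
  have -> : A * D = 2 * (c * L * (q `^ (4 / q) * D `^ (4 / q) / sigma `^ (4 / q))).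
    by rewrite Dq /A; ring.
  by rewrite ler_pM2l// ler_wpM2l ?mulr_ge0// ler_pdivlMr// mulrC.
rewrite ler_pdivrMr ?exprn_gt0//.
have := ler_wpM2r (ltW D0) AN; lra.
Qed.

Lemma absz_max_ceilE (R : realType) (x : R) :
  `|Num.max (Num.ceil x) 1|%N%:R = (Num.max (Num.ceil x) 1)%:~R :> R.
Proof. by rewrite natr_absz ger0_norm// le_max orbT. Qed.

Lemma absz_max_ceil_gt0 (R : realType) (x : R) :
  (1 <= `|Num.max (Num.ceil x) 1|)%N.
Proof. by rewrite absz_gt0 gt_eqF// lt_max orbT. Qed.

Lemma absz_max_ceil_ge (R : realType) (x : R) :
  x <= `|Num.max (Num.ceil x) 1|%N%:R.
Proof.
by rewrite absz_max_ceilE (le_trans (ceil_ge x))// ler_int le_max lexx.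
Qed.

Lemma absz_max_ceil_le (R : realType) (x : R) :
  0 <= x -> `|Num.max (Num.ceil x) 1|%N%:R <= x + 1.
Proof.
move=> x0; rewrite absz_max_ceilE.
case: (leP (Num.ceil x) 1) => _; first by rewrite mulr1z lerDr.
by have := ceilB1_lt x; rewrite intrD ltrBlDr => /ltW.
Qed.

(** Separating the dependence on [i] exhibits the step counts, before
    rounding, as a geometric sequence. *)
Lemma restart_powR_geometric (R : realType) (L3 q sigma Delta0 : R) (i : nat) :
  0 <= L3 -> 0 < q -> 0 < sigma -> 0 < Delta0 ->
  (2 * hyperfast_const * L3 * q `^ (4 / q) / sigma `^ (4 / q)
     * restart_Delta Delta0 i `^ ((4 - q) / q)) `^ (1 / 5)
  = (2 * hyperfast_const * q `^ (4 / q)) `^ (1 / 5)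
    * (L3 `^ (1 / 5) / sigma `^ (4 / (5 * q)))
    * Delta0 `^ ((4 - q) / (5 * q))
    * 2 `^ (- (i%:R * ((4 - q) / (5 * q)))).
Proof.
move=> L0 q0 s0 D0; rewrite /restart_Delta.
have c0 : 0 <= 2 * hyperfast_const :> R by rewrite /hyperfast_const.
have e1 : 4 / (5 * q) = 4 / q * (1 / 5) by field; rewrite gt_eqF.
have e2 : (4 - q) / (5 * q) = (4 - q) / q * (1 / 5) by field; rewrite gt_eqF.
rewrite -powR_invn// -mulNr e1 e2 -!powRN -mulNr.
rewrite (powRM ((4 - q) / q)) ?powR_ge0 ?(ltW D0)//.
rewrite (mulrAC _ L3) !powRM ?mulr_ge0 ?powR_ge0//.
by rewrite -!powRrM -!mulrA !mulNr.
Qed.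

(** * The restarted method *)

(** Feasibility and the gap bound have to be carried together: the guarantee of
    the basic method needs a start in [Q], and the distance of that start to
    [xs] is controlled by its gap. *)
Lemma restart_invariant (R : realType) (d : nat) (M : opt_method R d)
    (Q : set 'rV[R]_d) (f : 'rV[R]_d -> R) (L3 q sigma Delta0 : R)
    (xs z0 : 'rV[R]_d) (k : nat) :
  basic_hyperfast M -> closed Q -> convex_set Q -> bounded_set Q ->
  lipschitz_third_derivative Q f L3 -> 0 < q -> 0 < sigma ->
  uniformly_convex Q f q sigma -> is_argmin Q f xs ->
  Q z0 -> 0 < Delta0 -> f z0 - f xs <= Delta0 ->
  let z := restarted_hyperfast M Q f L3 q sigma Delta0 z0 in
  Q (z k) /\ f (z k) - f xs <= restart_Delta Delta0 k.
Proof.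
move=> hM Qcl Qco Qbd hf q0 s0 ucf hxs Qz0 D0 gap z.
have L0 : 0 <= L3 by case: hf.
have c0 : 0 <= hyperfast_const :> R by rewrite /hyperfast_const.
elim: k => [|k [Qz IH]]; first by rewrite /restart_Delta expr0 invr1 mulr1.
have Dk0 : 0 < restart_Delta Delta0 k by rewrite divr_gt0 ?exprn_gt0.
have cf := uniformly_convex_convex Qco (ltW q0) (ltW s0) ucf.
have N1 : (1 <= restart_steps L3 q sigma Delta0 k)%N.
  exact: absz_max_ceil_gt0.
have [Qz' dec] := hM _ _ _ _ _ _ Qcl Qco Qbd cf hf hxs Qz N1.
split=> //; apply: le_trans dec _.
have -> : restart_Delta Delta0 k.+1 = restart_Delta Delta0 k / 2.
  by rewrite /restart_Delta exprSr invfM mulrA.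
apply: (restart_halves_gap (sigma := sigma)) (absz_max_ceil_ge _) => //.
- exact: norm2_ge0.
- by rewrite ltr0n.
- exact: le_trans (uniformly_convex_growth Qco q0 (ltW s0) ucf hxs Qz) IH.
Qed.

Unset Implicit Arguments.
Set Strict Implicit.

Theorem theorem5p2 (R : realType) (d : nat) (M : opt_method R d)
    (Q : set 'rV[R]_d) (f : 'rV[R]_d -> R) (L3 q sigma Delta0 : R)
    (xs z0 : 'rV[R]_d)
    (hM : basic_hyperfast M)
    (Qclosed : closed Q) (Qconvex : convex_set Q) (Qbounded : bounded_set Q)
    (hf : lipschitz_third_derivative Q f L3)
    (hq : 2 <= q <= 4) (hsigma : 0 < sigma)
    (hconv : uniformly_convex Q f q sigma)
    (hxs : is_argmin Q f xs)
    (hz0 : Q z0) (hDelta0 : 0 < Delta0) (hgap : f z0 - f xs <= Delta0)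
    (k : nat) :
  let z := restarted_hyperfast M Q f L3 q sigma Delta0 z0 in
  [/\ sigma / q * norm2 (z k - xs) `^ q <= f (z k) - f xs,
      f (z k) - f xs <= Delta0 * 2 ^- k &
      (total_steps L3 q sigma Delta0 k)%:R
        <= (2 * hyperfast_const * q `^ (4 / q)) `^ (1 / 5)
           * (L3 `^ (1 / 5) / sigma `^ (4 / (5 * q)))
           * Delta0 `^ ((4 - q) / (5 * q))
           * \sum_(i < k.+1) 2 `^ (- (i%:R * ((4 - q) / (5 * q))))
           + k%:R].
Proof.
move=> z; have /andP[q2 _] := hq.
have q0 : 0 < q by exact: lt_le_trans q2.
have L0 : 0 <= L3 by case: hf.
have [Qzk gapk] := restart_invariant k hM Qclosed Qconvex Qbounded hf q0 hsigma
  hconv hxs hz0 hDelta0 hgap.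
split=> //.
  exact: (uniformly_convex_growth Qconvex q0 (ltW hsigma) hconv hxs).
rewrite /total_steps natr_sum; set C := _ * _ * Delta0 `^ _.
have C0 : 0 <= C by rewrite !mulr_ge0 ?invr_ge0 ?powR_ge0.
apply: (@le_trans _ _
  (\sum_(i < k) (C * 2 `^ (- (i%:R * ((4 - q) / (5 * q)))) + 1))).
  apply: ler_sum => i _; rewrite -restart_powR_geometric//.
  exact: absz_max_ceil_le (powR_ge0 _ _).
rewrite big_split/= sumr_const card_ord lerD2r -mulr_sumr ler_wpM2l//.
by rewrite big_ord_recr/= lerDl powR_ge0.
Qed.
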